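(* Let $0\le r\le l\le k$ be integers, let $\mathbb{F}^k$ be the free group on generators $f_1,\dots,f_k$, and let $\mathbb{FQ}^k_l\subset\mathbb{F}^k$ be the union of $\{\mathbf{1}\}$ and the conjugacy classes of $f_1,\dots,f_l$. Let the braid group $\mathrm{Br}_r$ act on $\mathbb{F}^k$ by the Artin action on the subgroup generated by $f_1,\dots,f_r$, fixing $f_{r+1},\dots,f_k$. This action fixes the element $f_1\cdots f_r$, and the induced (entrywise) action of $\mathrm{Br}_r$ on the set of decompositions of $f_1\cdots f_r$ as a product of $r$ elements of $\mathbb{FQ}^k_l$, i.e. on the set $$\{(g_1,\dots,g_r)\in(\mathbb{FQ}^k_l)^r\;:\;g_1\cdots g_r=f_1\cdots f_r\},$$ is transitive.
   Context: The Artin action: for $1\le i\le r-1$ the standard generator $\mathfrak{b}_i\in\mathrm{Br}_r$ acts by the automorphism of $\mathbb{F}^k$ sending $f_i\mapsto f_{i+1}$, $f_{i+1}\mapsto f_{i+1}^{-1}f_if_{i+1}$, and fixing $f_j$ for $j\ne i,i+1$. (For $r\le 1$ the group $\mathrm{Br}_r$ is trivial.) *)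

(* Defs.v *)
From HB Require Import structures.
From mathcomp Require Import ssreflect ssrfun ssrbool eqtype ssrnat seq choice.
From mathcomp Require Import fintype tuple bigop monoid generic_quotient.
From mathcomp Require Import boolp classical_sets zify.

Set Implicit Arguments.
Unset Strict Implicit.
Unset Printing Implicit Defensive.

Local Open Scope classical_set_scope.
Local Open Scope quotient_scope.
Local Open Scope group_scope.

(** The letter [(x, false)] stands for [x], and [(x, true)] for its inverse. *)
Definition word (X : Type) := seq (X * bool).

Inductive pres_eqv (X : Type) (R : word X -> word X -> Prop) :
    word X -> word X -> Prop :=
| PresRefl u : pres_eqv R u u
| PresSym u v : pres_eqv R u v -> pres_eqv R v u
| PresTrans u v w : pres_eqv R u v -> pres_eqv R v w -> pres_eqv R u w
| PresCat u u' v v' :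
    pres_eqv R u u' -> pres_eqv R v v' -> pres_eqv R (u ++ v) (u' ++ v')
| PresCancel x b : pres_eqv R [:: (x, b); (x, ~~ b)] [::]
| PresRel u v : R u v -> pres_eqv R u v.

Section Presented.
Variables (X : choiceType) (R : word X -> word X -> Prop).

Definition pres_eqb : rel (word X) := fun u v => `[< pres_eqv R u v >].

Fact pres_eqb_refl : reflexive pres_eqb.
Proof. by move=> u; apply/asboolP; apply: PresRefl. Qed.

Fact pres_eqb_sym : symmetric pres_eqb.
Proof. by move=> u v; apply/asboolP/asboolP; apply: PresSym. Qed.

Fact pres_eqb_trans : transitive pres_eqb.
Proof.
by move=> v u w /asboolP uv /asboolP vw; apply/asboolP; apply: PresTrans uv vw.
Qed.

Canonical pres_equiv := EquivRel pres_eqb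
  pres_eqb_refl pres_eqb_sym pres_eqb_trans.

(** The group with generators [X] and relations [u = v] for [R u v]. *)
Definition presented := {eq_quot pres_equiv}.

HB.instance Definition _ := Choice.on presented.
HB.instance Definition _ := Quotient.on presented.

Definition pres_class (u : word X) : presented := \pi_presented u.

Lemma pres_classP u v : pres_class u = pres_class v <-> pres_eqv R u v.
Proof.
rewrite /pres_class; split=> [/eqmodP /asboolP //|uv].
by apply/eqmodP/asboolP.
Qed.

Lemma pres_reprP u : pres_eqv R (repr (pres_class u)) u.
Proof. by apply/pres_classP; rewrite /pres_class reprK. Qed.

Definition winv (u : word X) : word X := rev [seq (a.1, ~~ a.2) | a <- u].

Lemma winv_cons a u : winv (a :: u) = winv u ++ [:: (a.1, ~~ a.2)].
Proof. by rewrite /winv /= rev_cons cats1. Qed.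

Lemma winv_cat u v : winv (u ++ v) = winv v ++ winv u.
Proof. by rewrite /winv map_cat rev_cat. Qed.

Lemma winvK : involutive winv.
Proof.
move=> u; rewrite /winv map_rev revK -map_comp map_id_in // => -[x b] _ /=.
by rewrite negbK.
Qed.

Lemma pres_eqv_mulV u : pres_eqv R (u ++ winv u) [::].
Proof.
elim: u => [|[x b] u IHu]; first exact: PresRefl.
rewrite winv_cons -cat1s -catA (catA u) /=.
apply: PresTrans (PresCancel R x b).
rewrite -(cat1s _ [:: (x, ~~ b)]) -cat1s; apply: PresCat; first exact: PresRefl.
rewrite -[X in pres_eqv R _ X]cat0s.
by apply: PresCat => //; apply: PresRefl.
Qed.

Lemma pres_eqv_Vmul u : pres_eqv R (winv u ++ u) [::].
Proof. by have := pres_eqv_mulV (winv u); rewrite winvK. Qed.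

Lemma pres_eqv_inv u v : pres_eqv R u v -> pres_eqv R (winv u) (winv v).
Proof.
move=> uv; apply: (@PresTrans _ _ _ (winv u ++ (v ++ winv v))).
  rewrite -{1}[winv u]cats0; apply: PresCat; first exact: PresRefl.
  exact/PresSym/pres_eqv_mulV.
rewrite catA -[X in pres_eqv R _ X]cat0s; apply: PresCat; last exact: PresRefl.
apply: PresTrans (pres_eqv_Vmul u); apply: PresCat; first exact: PresRefl.
exact: PresSym.
Qed.

Definition pres_one := pres_class [::].
Definition pres_mul (p q : presented) := pres_class (repr p ++ repr q).
Definition pres_inv (p : presented) := pres_class (winv (repr p)).

Lemma pres_surj p : exists u, p = pres_class u.
Proof. by exists (repr p); rewrite /pres_class reprK. Qed.

Lemma pres_mulE u v : pres_mul (pres_class u) (pres_class v) = pres_class (u ++ v).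
Proof. by apply/pres_classP; apply: PresCat; apply: pres_reprP. Qed.

Lemma pres_invE u : pres_inv (pres_class u) = pres_class (winv u).
Proof. by apply/pres_classP; apply: pres_eqv_inv; apply: pres_reprP. Qed.

Fact pres_mulA : associative pres_mul.
Proof.
move=> p q t; have [u ->] := pres_surj p; have [v ->] := pres_surj q.
have [w ->] := pres_surj t.
by rewrite !pres_mulE catA.
Qed.

Fact pres_mul1p : left_id pres_one pres_mul.
Proof. by move=> p; have [u ->] := pres_surj p; rewrite pres_mulE. Qed.

Fact pres_mulp1 : right_id pres_one pres_mul.
Proof. by move=> p; have [u ->] := pres_surj p; rewrite pres_mulE cats0. Qed.

Fact pres_mulVp : left_inverse pres_one pres_inv pres_mul.
Proof.
move=> p; have [u ->] := pres_surj p; rewrite pres_invE pres_mulE.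
exact/pres_classP/pres_eqv_Vmul.
Qed.

Fact pres_mulpV : right_inverse pres_one pres_inv pres_mul.
Proof.
move=> p; have [u ->] := pres_surj p; rewrite pres_invE pres_mulE.
exact/pres_classP/pres_eqv_mulV.
Qed.

HB.instance Definition _ := isGroup.Build presented
  pres_mulA pres_mul1p pres_mulp1 pres_mulVp pres_mulpV.

Definition pres_gen (x : X) : presented := pres_class [:: (x, false)].

Lemma pres_classM u v : pres_class (u ++ v) = pres_class u * pres_class v.
Proof. by rewrite -pres_mulE. Qed.

Lemma pres_class_letter x b :
  pres_class [:: (x, b)] = if b then (pres_gen x)^-1 else pres_gen x.
Proof. by case: b => //; symmetry; exact: pres_invE. Qed.

End Presented.

Arguments pres_gen {X} R x.

Section Lift.
Variables (X : choiceType) (R : word X -> word X -> Prop).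
Variables (G : groupType) (phi : X -> G).

Definition weval (u : word X) : G :=
  \prod_(a <- u) (if a.2 then (phi a.1)^-1 else phi a.1).

Lemma weval_cat u v : weval (u ++ v) = weval u * weval v.
Proof. by rewrite /weval big_cat. Qed.

Hypothesis phiR : forall u v, R u v -> weval u = weval v.

Lemma weval_eqv u v : pres_eqv R u v -> weval u = weval v.
Proof.
elim=> // [u1 u2 u3 _ -> _ -> //|u1 u2 v1 v2 _ e1 _ e2|x b].
  by rewrite !weval_cat e1 e2.
rewrite /weval !big_cons big_nil mulg1.
by case: b; rewrite /= ?mulgV ?mulVg.
Qed.

(** [phiR] is an argument so that the morphism instance below can use it. *)
Definition pres_lift (p : presented R) : G := let _ := phiR in weval (repr p).

Lemma pres_lift_class u : pres_lift (pres_class R u) = weval u.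
Proof. by apply: weval_eqv; apply: pres_reprP. Qed.

Lemma pres_lift_gen x : pres_lift (pres_gen R x) = phi x.
Proof. by rewrite pres_lift_class /weval big_seq1. Qed.

Fact pres_lift_morph : monoid_morphism pres_lift.
Proof.
split; first by rewrite [LHS]pres_lift_class /weval big_nil.
move=> p q; have [u ->] := pres_surj p; have [v ->] := pres_surj q.
by rewrite -pres_classM !pres_lift_class weval_cat.
Qed.

HB.instance Definition _ :=
  isUMagmaMorphism.Build (presented R) G pres_lift pres_lift_morph.

End Lift.

Lemma gmorph1 (G H : groupType) (f : G -> H) : {morph f : x y / x * y} -> f 1 = 1.
Proof. by move=> fM; apply: (@mulgI _ (f 1)); rewrite -fM !mulg1. Qed.

Lemma gmorphV (G H : groupType) (f : G -> H) :
  {morph f : x y / x * y} -> {morph f : x / x^-1}.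
Proof.
by move=> fM x; apply: (@mulgI _ (f x)); rewrite -fM !mulgV gmorph1.
Qed.

Lemma pres_morph_ext (X : choiceType) (R : word X -> word X -> Prop)
    (G : groupType) (f g : presented R -> G) :
    {morph f : x y / x * y} -> {morph g : x y / x * y} ->
  (forall x, f (pres_gen R x) = g (pres_gen R x)) -> f =1 g.
Proof.
move=> fM gM fg; move=> p; have [w ->] := pres_surj p; elim: w => [|[x b] u IHu].
  by rewrite (gmorph1 fM) (gmorph1 gM).
rewrite -cat1s pres_classM fM gM IHu pres_class_letter.
by case: b; rewrite ?(gmorphV fM) ?(gmorphV gM) fg.
Qed.

Record group_aut (G : groupType) := MkGroupAut {
  aut_fun :> G -> G;
  aut_inv : G -> G;
  autM : {morph aut_fun : x y / x * y};
  autK : cancel aut_fun aut_inv;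
  autVK : cancel aut_inv aut_fun
}.

Section AutGroup.
Variable G : groupType.

HB.instance Definition _ := gen_eqMixin (group_aut G).
HB.instance Definition _ := gen_choiceMixin (group_aut G).

Lemma autP (s t : group_aut G) : s =1 t -> s = t.
Proof.
case: s => f f' fM fK f'K; case: t => g g' gM gK g'K /= /funext fg.
subst g; have fg' : f' = g'.
  by apply/funext=> x; apply: (can_inj fK); rewrite f'K g'K.
by subst g'; congr MkGroupAut; apply: Prop_irrelevance.
Qed.

Definition aut_one : group_aut G :=
  @MkGroupAut G id id (fun _ _ => erefl) (fun _ => erefl) (fun _ => erefl).

Fact aut_comp_morph (s t : group_aut G) : {morph s \o t : x y / x * y}.
Proof. by move=> x y; rewrite /= !autM. Qed.

Definition aut_mul (s t : group_aut G) : group_aut G :=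
  MkGroupAut (@aut_comp_morph s t)
    (can_comp (@autK G s) (@autK G t)) (can_comp (@autVK G t) (@autVK G s)).

Fact aut_inv_morph (s : group_aut G) : {morph aut_inv s : x y / x * y}.
Proof.
by move=> x y; apply: (can_inj (autK s)); rewrite autM !autVK.
Qed.

Definition aut_V (s : group_aut G) : group_aut G :=
  MkGroupAut (@aut_inv_morph s) (@autVK G s) (@autK G s).

Fact aut_mulA : associative aut_mul.
Proof. by move=> s t u; apply: autP. Qed.
Fact aut_mul1s : left_id aut_one aut_mul.
Proof. by move=> s; apply: autP. Qed.
Fact aut_muls1 : right_id aut_one aut_mul.
Proof. by move=> s; apply: autP. Qed.
Fact aut_mulVs : left_inverse aut_one aut_V aut_mul.
Proof. by move=> s; apply: autP => x /=; rewrite autK. Qed.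
Fact aut_mulsV : right_inverse aut_one aut_V aut_mul.
Proof. by move=> s; apply: autP => x /=; rewrite autVK. Qed.

HB.instance Definition _ := isGroup.Build (group_aut G)
  aut_mulA aut_mul1s aut_muls1 aut_mulVs aut_mulsV.

Lemma aut1E (x : G) : (1 : group_aut G) x = x. Proof. by []. Qed.
Lemma autME (s t : group_aut G) x : (s * t) x = s (t x). Proof. by []. Qed.

Lemma aut1 (s : group_aut G) : s 1 = 1. Proof. exact/gmorph1/autM. Qed.
Lemma autV (s : group_aut G) x : s x^-1 = (s x)^-1.
Proof. exact/gmorphV/autM. Qed.
Lemma autJ (s : group_aut G) x y : s (x ^ y) = s x ^ s y.
Proof. by rewrite !conjgE !autM autV. Qed.

End AutGroup.

Definition free_group (k : nat) := presented (fun _ _ : word 'I_k => False).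
HB.instance Definition _ k := Group.on (free_group k).

Definition fgen (k : nat) (j : 'I_k) : free_group k := pres_gen _ j.

Definition flift (k : nat) (G : groupType) (phi : 'I_k -> G) :
    free_group k -> G :=
  pres_lift (fun u v (uv : False) => False_ind (weval phi u = weval phi v) uv).

Lemma fliftM k G phi : {morph @flift k G phi : x y / x * y}.
Proof. by move=> x y; rewrite [LHS]gmulfM. Qed.

Lemma flift_gen k G phi j : @flift k G phi (fgen j) = phi j.
Proof. exact: pres_lift_gen. Qed.

Lemma free_ext k (G : groupType) (f g : free_group k -> G) :
    {morph f : x y / x * y} -> {morph g : x y / x * y} ->
  (forall j, f (fgen j) = g (fgen j)) -> f =1 g.
Proof. exact: pres_morph_ext. Qed.

Definition pos_letter (n : nat) (i : 'I_n) : 'I_n * bool := (i, false).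

Inductive braid_rel (n : nat) : word 'I_n -> word 'I_n -> Prop :=
| BraidFar (i j : 'I_n) : (i.+1 < j)%N ->
    braid_rel (map (@pos_letter n) [:: i; j]) (map (@pos_letter n) [:: j; i])
| BraidNear (i j : 'I_n) : i.+1 = j :> nat ->
    braid_rel (map (@pos_letter n) [:: i; j; i])
              (map (@pos_letter n) [:: j; i; j]).

(** The braid group on [r] strands has [r.-1] standard generators, hence is
    trivial for [r <= 1]. *)
Definition braid_group (r : nat) := presented (@braid_rel r.-1).
HB.instance Definition _ r := Group.on (braid_group r).

Definition bgen (r : nat) (i : 'I_r.-1) : braid_group r := pres_gen _ i.

Section Artin.
Variables (r k : nat) (hrk : (r <= k)%N).

Fact strand_proof (i : 'I_r.-1) : (i < k)%N.
Proof. by have := ltn_ord i; lia. Qed.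

Fact strandS_proof (i : 'I_r.-1) : (i.+1 < k)%N.
Proof. by have := ltn_ord i; lia. Qed.

(** Indices start at 0: generator [i] involves strands [i] and [i.+1]. *)
Definition strand (i : 'I_r.-1) : 'I_k := Ordinal (strand_proof i).
Definition strandS (i : 'I_r.-1) : 'I_k := Ordinal (strandS_proof i).

(** [x ^ y] is the conjugate [y^-1 * x * y]. *)
Definition artin_img (i : 'I_r.-1) (j : 'I_k) : free_group k :=
  if j == strand i then fgen (strandS i)
  else if j == strandS i then fgen (strand i) ^ fgen (strandS i)
  else fgen j.

Definition artin_invimg (i : 'I_r.-1) (j : 'I_k) : free_group k :=
  if j == strand i then fgen (strandS i) ^ (fgen (strand i))^-1
  else if j == strandS i then fgen (strand i)
  else fgen j.

Lemma strandS_neq i : (strandS i == strand i) = false.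
Proof. by apply/negbTE; rewrite -val_eqE /= neq_ltn ltnSn orbT. Qed.

Fact artin_genK i : cancel (flift (artin_img i)) (flift (artin_invimg i)).
Proof.
apply: (@free_ext _ _ (flift (artin_invimg i) \o flift (artin_img i)) id) => //.
  by move=> x y /=; rewrite !fliftM.
move=> j /=; rewrite flift_gen /artin_img.
have [->|jN] := eqVneq j (strand i).
  by rewrite flift_gen /artin_invimg strandS_neq eqxx.
have [->|jNS] := eqVneq j (strandS i).
  rewrite conjgE !fliftM (gmorphV (@fliftM _ _ _)) !flift_gen /artin_invimg.
  by rewrite strandS_neq !eqxx conjgE invgK !mulgA mulVg mul1g mulgVK.
by rewrite flift_gen /artin_invimg (negbTE jN) (negbTE jNS).
Qed.

Fact artin_genVK i : cancel (flift (artin_invimg i)) (flift (artin_img i)).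
Proof.
apply: (@free_ext _ _ (flift (artin_img i) \o flift (artin_invimg i)) id) => //.
  by move=> x y /=; rewrite !fliftM.
move=> j /=; rewrite flift_gen /artin_invimg.
have [->|jN] := eqVneq j (strand i).
  rewrite conjgE invgK !fliftM (gmorphV (@fliftM _ _ _)) !flift_gen /artin_img.
  by rewrite strandS_neq !eqxx conjgE !mulgA mulgV mul1g mulgK.
have [->|jNS] := eqVneq j (strandS i).
  by rewrite flift_gen /artin_img eqxx.
by rewrite flift_gen /artin_img (negbTE jN) (negbTE jNS).
Qed.

Definition artin_gen (i : 'I_r.-1) : group_aut (free_group k) :=
  MkGroupAut (@fliftM _ _ (artin_img i)) (@artin_genK i) (@artin_genVK i).

Lemma artin_gen_strand (i : 'I_r.-1) (j : 'I_k) : val j = i ->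
  artin_gen i (fgen j) = fgen (strandS i).
Proof.
by move=> ji; rewrite [LHS]flift_gen /artin_img -val_eqE /= ji eqxx.
Qed.

Lemma artin_gen_strandS (i : 'I_r.-1) (j : 'I_k) : val j = i.+1 ->
  artin_gen i (fgen j) = fgen (strand i) ^ fgen (strandS i).
Proof.
move=> ji; have -> : j = strandS i by apply: val_inj.
by rewrite [LHS]flift_gen /artin_img strandS_neq eqxx.
Qed.

Lemma artin_gen_fix (i : 'I_r.-1) (j : 'I_k) : val j != i -> val j != i.+1 ->
  artin_gen i (fgen j) = fgen j.
Proof.
move=> /negbTE ji /negbTE jSi.
by rewrite [LHS]flift_gen /artin_img -!val_eqE /= ji jSi.
Qed.

Fact artin_braid_rel u v :
  braid_rel u v -> weval artin_gen u = weval artin_gen v.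
Proof.
case=> i j ij; rewrite /weval !big_cons !big_nil /= !mulg1; apply: autP;
  apply: free_ext; try exact: autM; move=> m; rewrite !autME.
- have fixj : forall a : 'I_k, (val a < j)%N -> artin_gen j (fgen a) = fgen a.
    by move=> a aj; apply: artin_gen_fix; lia.
  have fixi : forall a : 'I_k, (j <= val a)%N -> artin_gen i (fgen a) = fgen a.
    by move=> a aj; apply: artin_gen_fix; lia.
  have [/eqP mi|mi] := boolP (val m == i).
    by rewrite (fixj m) ?(artin_gen_strand mi) ?fixj //= ?mi; lia.
  have [/eqP mSi|mSi] := boolP (val m == i.+1).
    rewrite (fixj m) ?(artin_gen_strandS mSi) ?autJ ?fixj //= ?mSi //; lia.
  rewrite [in RHS](artin_gen_fix mi mSi).
  have [/eqP mj|mj] := boolP (val m == j).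
    by rewrite (artin_gen_strand mj) fixi.
  have [/eqP mSj|mSj] := boolP (val m == j.+1).
    by rewrite (artin_gen_strandS mSj) autJ !fixi //=.
  by rewrite !(artin_gen_fix mj mSj) artin_gen_fix.
have Sij : strandS i = strand j by apply: val_inj.
have [/eqP mi|mi] := boolP (val m == i).
  rewrite (artin_gen_strand mi) (artin_gen_strand (j := strandS i)) //.
  rewrite (artin_gen_fix (i := j) (j := m)) ?mi; try lia.
  rewrite (artin_gen_strand mi) Sij (artin_gen_strand (j := strand j)) //.
  by rewrite artin_gen_fix //=; lia.
have [/eqP mSi|mSi] := boolP (val m == i.+1).
  have mj : val m = j by rewrite mSi.
  rewrite (artin_gen_strandS mSi) (artin_gen_strand mj) !autJ.
  rewrite (artin_gen_fix (i := j) (j := strand i)); try by move=> /=; lia.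
  rewrite (artin_gen_strand (i := i) (j := strand i)) // Sij.
  rewrite (artin_gen_strand (i := j) (j := strand j)) //.
  rewrite (artin_gen_fix (i := i) (j := strandS j)); try by move=> /=; lia.
  by rewrite artin_gen_strandS.
rewrite [in LHS](artin_gen_fix mi mSi).
have [/eqP mSj|mSj] := boolP (val m == j.+1).
  rewrite (artin_gen_strandS mSj) !autJ.
  rewrite (artin_gen_fix (i := i) (j := strandS j)); try by move=> /=; lia.
  rewrite (artin_gen_strandS (i := i) (j := strand j)) // !autJ Sij.
  rewrite (artin_gen_fix (i := j) (j := strand i)); try by move=> /=; lia.
  rewrite (artin_gen_strand (i := j) (j := strand j)) //.
  by rewrite (artin_gen_strandS (i := j) (j := strandS j)) // -!conjgM -conjgC.
have mj : val m != j by lia.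
by rewrite (artin_gen_fix mj mSj) (artin_gen_fix mi mSi) (artin_gen_fix mj mSj).
Qed.

(** The homomorphism through which [braid_group r] acts; products of
    automorphisms are composites [(s * t) x = s (t x)], so it is a left
    action. *)
Definition artin : braid_group r -> group_aut (free_group k) :=
  pres_lift artin_braid_rel.

Lemma artin1 : artin 1 = 1.
Proof. exact: gmulf1. Qed.

Lemma artinM : {morph artin : b c / b * c}.
Proof. exact: gmulfM. Qed.

Lemma artin_bgen i : artin (bgen i) = artin_gen i.
Proof. exact: pres_lift_gen. Qed.

Definition fprod : free_group k := \prod_(i < r) fgen (widen_ord hrk i).

End Artin.

Definition conj_class (G : groupType) (x : G) : set G :=
  [set x ^ y | y in [set: G]].

Definition FQ (k l : nat) : set (free_group k) :=
  [set 1] `|` \bigcup_(j in [set j : 'I_k | (j < l)%N]) conj_class (fgen j).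

Definition decompositions (r l k : nat) (hrk : (r <= k)%N) :
    set (r.-tuple (free_group k)) :=
  [set g | (forall i, FQ l (tnth g i)) /\
           \prod_(i < r) tnth g i = fprod hrk].

Definition artin_tuple (r k : nat) (hrk : (r <= k)%N) (b : braid_group r)
    (g : r.-tuple (free_group k)) : r.-tuple (free_group k) :=
  map_tuple (artin hrk b) g.

Definition transitive_on (G T : Type) (act : G -> T -> T) (S : set T) : Prop :=
  [/\ S !=set0,
      forall b x, S x -> S (act b x)
    & forall x y, S x -> S y -> exists b, act b x = y].

(* Main.v *)
Require Import Defs.
From mathcomp Require Import ssreflect ssrfun ssrbool eqtype ssrnat seq choice.
From mathcomp Require Import path fintype tuple bigop monoid ssralg ssrnum.
From mathcomp Require Import ssrint zify classical_sets.

(** A Hurwitz move replaces adjacent entries [a, b] by [b, a ^ b].  Applied to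
    [(f_1, ..., f_r)] it is the entrywise action of a standard braid generator,
    and Hurwitz moves commute with entrywise automorphisms, so the braid orbit
    of [(f_1, ..., f_r)] is stable under Hurwitz moves and their inverses.  It
    thus suffices to reach [(f_1, ..., f_r)] from any decomposition by such
    moves.  The exponent sum rules out trivial entries, so each entry is a
    reduced word [A^-1 x A] with [x] a generator.  If cancellation in the
    product reaches some middle letter [x], a move decreases the sum of the
    lengths of the [A]s.  Otherwise all [r] middle letters survive, and since
    [f_1 ... f_r] has length [r], every [A] is empty. *)

Set Implicit Arguments.
Unset Strict Implicit.
Unset Printing Implicit Defensive.

Local Open Scope group_scope.

(** * Letters, common suffixes and Hurwitz equivalence *)

Definition letter_inv (X : Type) (a : X * bool) : X * bool := (a.1, ~~ a.2).

Lemma letter_invK X : involutive (@letter_inv X).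
Proof. by case=> x b; rewrite /letter_inv /= negbK. Qed.

Lemma letter_inv_eq (X : eqType) (a b : X * bool) :
  (letter_inv a == b) = (a == letter_inv b).
Proof. exact/can2_eq/letter_invK/letter_invK. Qed.

(** Isolates what cancels freely in [s t^-1]: exactly the shared suffix [c]. The last clause makes
    [c] maximal, so that nothing cancels between [p] and [q^-1] afterwards. *)
Lemma longest_common_suffix (T : eqType) (s t : seq T) :
  exists p q c, [/\ s = p ++ c, t = q ++ c &
    forall p' q' a b, p = rcons p' a -> q = rcons q' b -> a != b].
Proof.
elim/last_ind: s t => [|s a IHs] t.
  by exists [::], t, [::]; rewrite !cats0; split=> // -[].
case/lastP: t => [|t b].
  by exists (rcons s a), [::], [::]; rewrite !cats0; split=> // ? [].
have [<-{b}|ab] := eqVneq a b.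
  have [p [q [c [-> -> pq]]]] := IHs t.
  by exists p, q, (rcons c a); rewrite !rcons_cat.
exists (rcons s a), (rcons t b), [::]; rewrite !cats0; split=> //.
by move=> p' q' a' b' /rcons_inj[_ <-] /rcons_inj[_ <-].
Qed.

Inductive hurwitz (G : groupType) : seq G -> seq G -> Prop :=
| HurwitzRefl s : hurwitz s s
| HurwitzSym s t : hurwitz s t -> hurwitz t s
| HurwitzTrans s t u : hurwitz s t -> hurwitz t u -> hurwitz s u
| HurwitzMove s (a b : G) t :
    hurwitz (s ++ [:: a, b & t]) (s ++ [:: b, a ^ b & t]).

Lemma hurwitz_prod (G : groupType) (s t : seq G) :
  hurwitz s t -> \prod_(a <- s) a = \prod_(a <- t) a.
Proof.
elim=> // [s1 s2 s3 _ -> _ -> //|s1 a b s2].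
by rewrite !big_cat !big_cons /= (mulgA a) (mulgA b) (conjgC a b).
Qed.

Section FreeGroup.
Variable X : choiceType.
Implicit Types (u v w A B C : word X) (a b : X * bool) (x y : X).

Local Notation no_rel := (fun _ _ : word X => False).
Local Notation FG := (presented no_rel).
Local Notation cls := (pres_class no_rel).
Local Notation eqv := (pres_eqv no_rel).

(** * Reduced words and normal forms in a free group *)

Definition reduced w := sorted (fun a b => b != letter_inv a) w.

Lemma reduced_cat u v : reduced (u ++ v) -> reduced u /\ reduced v.
Proof.
move=> uv; split.
  exact: (infix_sorted (prefixW (prefix_prefix u v)) uv).
exact: (infix_sorted (suffixW (suffix_suffix u v)) uv).
Qed.

Lemma reduced_cat_rcons u a b v :
  reduced (rcons u a ++ b :: v) =
  [&& reduced (rcons u a), reduced (b :: v) & b != letter_inv a].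
Proof.
rewrite /reduced sorted_cat_cons; case: u => [|c u]; first by rewrite /= andbT andbC.
by rewrite !rcons_cons /= !rcons_path last_rcons; do ?case: path;
  rewrite /= ?andbT ?andbF // andbC.
Qed.

Lemma reduced_winv u : reduced (winv u) = reduced u.
Proof.
rewrite /reduced /winv rev_sorted sorted_map; apply: eq_sorted => a b /=.
by rewrite [(_.1, _)]/(letter_inv _) eq_sym -/(letter_inv b) letter_invK.
Qed.

Definition push a w : word X :=
  if w is b :: w' then if b == letter_inv a then w' else a :: w else [:: a].

Definition normal_form w := foldr push [::] w.

Lemma push_reduced a w : reduced w -> reduced (push a w).
Proof.
case: w => [|b w] //= bw; have [_|ba] := eqVneq; last by rewrite /reduced /= ba.
exact: path_sorted bw.
Qed.

Lemma foldr_push_reduced u w : reduced w -> reduced (foldr push w u).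
Proof. by move=> wr; elim: u => //= a u; apply: push_reduced. Qed.

Lemma push_cancel a w : reduced w -> push a (push (letter_inv a) w) = w.
Proof.
case: w => [|b w] /=; first by rewrite eqxx.
rewrite letter_invK; have [->|ba] := eqVneq b a; last by rewrite /= eqxx.
(* Here the first push removed the leading [a]. As the word was reduced, the next letter is not the
   inverse of [a], so pushing [a] restores it. *)
by case: w => //= c w /andP[/negbTE ->].
Qed.

(** Van der Waerden's argument: by [push_cancel] a letter and its inverse act on reduced words as
    mutually inverse maps, so the action of a word depends only on its class. Acting on the empty
    word then shows that reduced representatives are unique. *)
Lemma foldr_push_eqv u v : eqv u v ->
  forall w, reduced w -> foldr push w u = foldr push w v.
Proof.
elim=> //= [u1 v1 _ IH|u1 u2 u3 _ IH1 _ IH2|u1 u2 v1 v2 _ IHu _ IHv|x b] w wr.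
- by rewrite IH.
- by rewrite IH1 ?IH2.
- by rewrite !foldr_cat IHv // IHu //; apply: foldr_push_reduced.
- exact: (push_cancel (x, b)).
Qed.

Lemma normal_form_id w : reduced w -> normal_form w = w.
Proof.
elim: w => //= a w IHw aw; rewrite /normal_form /= -/(normal_form w) IHw.
  by case: w aw {IHw} => //= b w /andP[/negbTE ->].
exact: path_sorted aw.
Qed.

Lemma reduced_inj u v : reduced u -> reduced v -> cls u = cls v -> u = v.
Proof.
move=> ur vr /pres_classP uv.
by rewrite -(normal_form_id ur) -(normal_form_id vr) /normal_form (foldr_push_eqv uv).
Qed.

Lemma cls_cons a u : cls (a :: u) = cls [:: a] * cls u.
Proof. by rewrite -pres_classM. Qed.

Lemma cls_winv u : cls (winv u) = (cls u)^-1.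
Proof. by symmetry; exact: pres_invE. Qed.

Lemma cls_letter_inv a : cls [:: letter_inv a] = (cls [:: a])^-1.
Proof. by rewrite -cls_winv. Qed.

Lemma cls_normal_form w : cls (normal_form w) = cls w.
Proof.
elim: w => //= a w IHw; rewrite [in RHS]cls_cons -IHw.
rewrite /normal_form /= -/(normal_form w).
case: (normal_form w) => [|b v] /=; first by rewrite [cls [::]]/(1 : FG) mulg1.
have [->|_] := eqVneq; last by rewrite -cls_cons.
by rewrite (cls_cons (letter_inv a)) cls_letter_inv mulVKg.
Qed.

Lemma size_normal_form w : size (normal_form w) <= size w.
Proof.
elim: w => //= a w; rewrite /normal_form /= -/(normal_form w).
by case: (normal_form w) => //= b v; case: ifP => //= _; lia.
Qed.

(** * Conjugates of generators and cancellation between neighbours *)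

Definition conj_word x A : word X := winv A ++ (x, false) :: A.

Lemma cls_conj_word x A : cls (conj_word x A) = pres_gen _ x ^ cls A.
Proof. by rewrite pres_classM cls_cons cls_winv. Qed.

(** Reduce [A], then strip its leading letters [x] and [x^-1], which commute with [x]. Once [A] is
    empty or starts with another generator, nothing cancels against the middle letter. *)
Lemma conj_word_reduced_rep x A : exists B,
  [/\ size B <= size A, reduced (conj_word x B) &
      cls (conj_word x B) = cls (conj_word x A)].
Proof.
suff H B : reduced B -> exists C, [/\ size C <= size B,
    reduced (conj_word x C) & pres_gen _ x ^ cls C = pres_gen _ x ^ cls B].
  have [|C [sC Cr eC]] := H (normal_form A); first exact: foldr_push_reduced.
  exists C; rewrite !cls_conj_word eC cls_normal_form; split=> //.
  exact: leq_trans sC (size_normal_form A).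
elim: B => [|[y c] B IHB] Br; first by exists [::].
have [eyx|nyx] := eqVneq y x.
  have [|C [sC Cr eC]] := IHB; first exact: path_sorted Br.
  exists C; split=> //; first exact: leqW.
  rewrite eC (cls_cons (y, c)) conjgM eyx; congr (_ ^ _).
  by rewrite pres_class_letter conjgE; case: c {Br}; rewrite ?mulKg // mulgV mulg1 invgK.
exists ((y, c) :: B); split=> //.
rewrite /conj_word winv_cons cats1 reduced_cat_rcons -cats1 -winv_cons.
rewrite reduced_winv Br /= /reduced /= !xpair_eqE /=.
by rewrite [x == y]eq_sym (negbTE nyx) andbT.
Qed.

Definition conj_elt (p : word X * X) : FG := cls (conj_word p.2 p.1).

(* The pair [(A, x)] stands for [A^-1 x A].  These are the two cases where the
   cancellation in a product of two such words reaches a middle letter. *)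
Definition shortenable (p q : word X * X) :=
  (exists C, q.1 = C ++ (p.2, false) :: p.1) \/
  (exists C, p.1 = C ++ (q.2, true) :: q.1).

Lemma winv_rcons u a : winv (rcons u a) = letter_inv a :: winv u.
Proof. by rewrite -cats1 winv_cat. Qed.

(** Write the conjugators as [P C] and [Q C] with [C] maximal. After [C] cancels, [m = P Q^-1]
    stands between the middle letters [x] and [y]. A further cancellation needs [P] empty and [Q]
    ending in [x], or [Q] empty and [P] ending in [y^-1]: the two shortenable cases. The tail [s] is
    arbitrary so that the lemma can be iterated along a product. *)
Lemma shortenable_or_reduced p q s :
  reduced (conj_word p.2 p.1) -> reduced (winv q.1 ++ (q.2, false) :: s) ->
  shortenable p q \/ exists m,
    [/\ reduced (winv p.1 ++ (p.2, false) :: m ++ (q.2, false) :: s),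
        conj_elt p * cls (winv q.1 ++ (q.2, false) :: s) =
          cls (winv p.1 ++ (p.2, false) :: m ++ (q.2, false) :: s) &
        m = [::] -> p.1 = q.1].
Proof.
case: p q => [A x] [B y] /=; rewrite /shortenable /conj_elt /conj_word /=.
have [P [Q [C [-> -> PQ]]]] := longest_common_suffix A B => pr qr.
set t := (y, false) :: s in qr *.
(* What remains of the two factors once [C] has cancelled is [u] and [winv Q ++ t]. Both are pieces
   of reduced words, so only their junction has to be examined. *)
set u := winv (P ++ C) ++ (x, false) :: P.
have ur : reduced u.
  by move: pr; rewrite -cat_cons catA => /reduced_cat[].
have vr : reduced (winv Q ++ t).
  by move: qr; rewrite winv_cat -catA => /reduced_cat[].
suff [?|uvr] : shortenable (P ++ C, x) (Q ++ C, y) \/ reduced (u ++ winv Q ++ t).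
- by left.
- right; exists (P ++ winv Q); split.
  + by move: uvr; rewrite /u -!catA.
  + rewrite -!cat_cons !pres_classM !cls_winv !pres_classM !invgM.
    by rewrite !mulgA mulgK.
  + case: P {pr ur uvr u PQ} => //= /(congr1 (@winv X)); rewrite winvK => -> //.
rewrite /shortenable /=; rewrite {}/u in ur *.
case/lastP: P => [|P a] in PQ pr ur *; case/lastP: Q => [|Q b] in PQ qr vr *.
- right; rewrite cats1 in ur *; rewrite reduced_cat_rcons ur.
  by rewrite [reduced (_ :: _)]vr xpair_eqE andbF.
- have [bx|bx] := eqVneq b (x, false).
    by left; left; exists Q; rewrite cat_rcons bx.
  right; rewrite cats1 winv_rcons in ur vr *.
  by rewrite reduced_cat_rcons ur vr (inj_eq (can_inj (@letter_invK X))).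
- have [ay|ay] := eqVneq a (y, true).
    by left; right; exists P; rewrite cat_rcons ay.
  right; rewrite -rcons_cons -rcons_cat in ur *.
  by rewrite reduced_cat_rcons ur vr -letter_inv_eq eq_sym.
right; rewrite -rcons_cons -rcons_cat winv_rcons in ur vr *.
rewrite reduced_cat_rcons ur vr (inj_eq (can_inj (@letter_invK X))) eq_sym.
exact: PQ.
Qed.


(** Built up from the right end: each new factor contributes its middle letter and a connecting word
    [m], which gives the lower bound on [size w]. If the bound is attained, every [m] is empty, so
    all conjugators agree with the last one, which is empty as well. *)
Lemma shortenable_pair_or_reduced p ps :
  {in p :: ps, forall q, reduced (conj_word q.2 q.1)} ->
  (exists s q q' t, p :: ps = s ++ [:: q, q' & t] /\ shortenable q q') \/
  exists w,
    [/\ reduced (winv p.1 ++ (p.2, false) :: w),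
        \prod_(q <- p :: ps) conj_elt q = cls (winv p.1 ++ (p.2, false) :: w),
        size ps <= size w &
        size w <= size ps -> all (fun q => q.1 == [::]) (p :: ps)].
Proof.
elim: ps p => [|q ps IH] p psr.
  right; exists p.1; rewrite big_seq1; split=> //.
    by apply: psr; rewrite inE.
  by rewrite leqn0 size_eq0 /= andbT.
have pr : reduced (conj_word p.2 p.1) by apply: psr; rewrite inE eqxx.
have [|[s [q1 [q2 [t [-> qq]]]]]|[w [wr wE sw psE]]] := IH q.
- by move=> q' qq'; apply: psr; rewrite inE qq' orbT.
- by left; exists (p :: s), q1, q2, t.
have [sh|[m [mr mE m0]]] := shortenable_or_reduced pr wr.
  by left; exists [::], p, q, ps.
right; exists (m ++ (q.2, false) :: w); split=> //.
  by rewrite big_cons wE mE.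
  by rewrite size_cat /= addnS ltnS (leq_trans sw) ?leq_addl.
rewrite size_cat /= addnS ltnS => sm.
have psN := psE (leq_trans (leq_addl _ _) sm).
have m_nil : m = [::].
  by apply/nilP; rewrite /nilp -leqn0 -(leq_add2r (size w)) (leq_trans sm).
by move: (psN) => /= /andP[/eqP q0 ->]; rewrite m0 // q0 eqxx.
Qed.

Definition hurwitz_pair (g h g' h' : FG) := g' = h /\ h' = g ^ h.

(** If the second conjugator is [C x A], then [y ^ (C x A)] is [y ^ (C A)] conjugated by [x ^ A],
    and an inverse move undoes this conjugation. If the first one is [C y^-1 B], a direct move
    conjugates [x ^ (C y^-1 B)] by [y ^ B], giving [x ^ (C B)]. Either way one letter is lost. *)
Lemma shortenable_hurwitz p q : shortenable p q ->
    reduced (conj_word p.2 p.1) -> reduced (conj_word q.2 q.1) ->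
  exists p' q', [/\ size p'.1 + size q'.1 < size p.1 + size q.1,
    reduced (conj_word p'.2 p'.1), reduced (conj_word q'.2 q'.1) &
    hurwitz_pair (conj_elt p) (conj_elt q) (conj_elt p') (conj_elt q') \/
    hurwitz_pair (conj_elt p') (conj_elt q') (conj_elt p) (conj_elt q)].
Proof.
case: p q => [A x] [B y]; rewrite /shortenable /conj_elt /hurwitz_pair /=.
move=> [] [C eC] pr qr.
  have [D [sD Dr eD]] := conj_word_reduced_rep y (C ++ A).
  exists (D, y), (A, x); split=> //=.
    by move: sD; rewrite eC !size_cat /=; lia.
  right; split=> //; rewrite eD eC !cls_conj_word -conjgM; congr (_ ^ _).
  rewrite !pres_classM cls_cons pres_class_letter conjgE.
  by rewrite -!mulgA mulVKg.
have [D [sD Dr eD]] := conj_word_reduced_rep x (C ++ B).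
exists (B, y), (D, x); split=> //=.
  by move: sD; rewrite eC !size_cat /=; lia.
left; split=> //; rewrite eD eC !cls_conj_word -conjgM; congr (_ ^ _).
rewrite !pres_classM cls_cons pres_class_letter conjgE.
by rewrite -!mulgA mulVKg mulKg.
Qed.

(** * Descent to the generators by Hurwitz moves *)

Definition pos_word (xs : seq X) : word X := [seq (x, false) | x <- xs].

Lemma pos_word_reduced xs : reduced (pos_word xs).
Proof.
case: xs => //= x xs; elim: xs x => //= y xs IH x.
by rewrite IH xpair_eqE andbF.
Qed.

Lemma cls_pos_word xs : cls (pos_word xs) = \prod_(x <- xs) pres_gen _ x.
Proof. by elim: xs => [|x xs IH]; rewrite ?big_nil ?big_cons // -IH -cls_cons. Qed.

Lemma hurwitz_conj_elts xs ps :
    {in ps, forall p, reduced (conj_word p.2 p.1)} -> size ps = size xs ->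
    \prod_(p <- ps) conj_elt p = \prod_(x <- xs) pres_gen _ x ->
  hurwitz (map conj_elt ps) (map (pres_gen _) xs).
Proof.
have [n] := ubnP (\sum_(p <- ps) size p.1)%N.
elim: n ps => // n IHn [|p ps] szn psr szx prodx.
  by case: xs szx {IHn prodx} => // _; apply: HurwitzRefl.
have [[s [q [q' [t [eps sh]]]]]|[w [wr wE sw psN]]] :=
  shortenable_pair_or_reduced psr.
  rewrite eps in szn psr szx prodx *.
  have [||r [r' [szr rr rr' rq]]] := shortenable_hurwitz sh.
  - by apply: psr; rewrite mem_cat !inE eqxx orbT.
  - by apply: psr; rewrite mem_cat !inE eqxx !orbT.
  have hr : hurwitz (map conj_elt (s ++ [:: q, q' & t]))
                    (map conj_elt (s ++ [:: r, r' & t])).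
    rewrite !map_cat /=.
    by case: rq => -[-> ->]; [|apply: HurwitzSym]; apply: HurwitzMove.
  apply: (HurwitzTrans hr); apply: IHn.
  - rewrite ltnS in szn; apply: leq_trans szn.
    by rewrite !big_cat !big_cons /= ltn_add2l !addnA ltn_add2r.
  - move=> u; rewrite mem_cat !inE => /orP[us|/or3P[/eqP->|/eqP->|ut]] //.
      by apply: psr; rewrite mem_cat us.
    by apply: psr; rewrite mem_cat !inE ut !orbT.
  - by rewrite -szx !size_cat.
  - by rewrite -prodx -!(big_map conj_elt xpredT id) (hurwitz_prod hr).
(* No pair is shortenable. Uniqueness of reduced words identifies the product word with
   [pos_word xs], whose length is [(size ps).+1]; the first middle letter takes one of these
   places. *)
have szw : size w <= size ps.
  move: prodx; rewrite wE -cls_pos_word => /(reduced_inj wr (pos_word_reduced xs)).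
  by move=> /(congr1 size); rewrite size_cat /= size_map -szx /=; lia.
have psE : map conj_elt (p :: ps) = map (pres_gen _) (map snd (p :: ps)).
  rewrite -map_comp; apply/eq_in_map => q /(allP (psN szw)) /eqP q0.
  by rewrite /conj_elt q0.
(* All conjugators are empty, so both products are positive words. These are reduced, hence equal
   letter by letter. *)
suff -> : xs = map snd (p :: ps) by rewrite psE; apply: HurwitzRefl.
suff : pos_word xs = pos_word (map snd (p :: ps)).
  by apply: inj_map => ? ? [].
apply: reduced_inj; try exact: pos_word_reduced.
by rewrite !cls_pos_word -prodx -(big_map conj_elt xpredT id) psE big_map.
Qed.

(** * Exponent sums and the exclusion of trivial entries *)

Definition exponent_sum (w : word X) : int := (\sum_(a <- w) (-1) ^+ a.2)%R.

Lemma exponent_sum_cat u v :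
  exponent_sum (u ++ v) = (exponent_sum u + exponent_sum v)%R.
Proof. exact: big_cat. Qed.

Lemma exponent_sum_eqv u v : eqv u v -> exponent_sum u = exponent_sum v.
Proof.
elim=> // [u1 u2 u3 _ -> _ -> //|u1 u2 v1 v2 _ e1 _ e2|x b].
  by rewrite !exponent_sum_cat e1 e2.
by rewrite /exponent_sum !big_cons !big_nil; case: b.
Qed.

Lemma exponent_sum_winv u : exponent_sum (winv u) = (- exponent_sum u)%R.
Proof.
apply: (@GRing.addrI _ (exponent_sum u)).
rewrite -exponent_sum_cat (exponent_sum_eqv (pres_eqv_mulV _ u)).
by rewrite GRing.subrr /exponent_sum big_nil.
Qed.

Lemma exponent_sum_conj_word x A : exponent_sum (conj_word x A) = 1%R.
Proof.
rewrite exponent_sum_cat -cat1s exponent_sum_cat exponent_sum_winv.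
by rewrite {2}/exponent_sum big_seq1 /= GRing.addrCA GRing.addNr.
Qed.

Lemma exponent_sum_pos_word xs : exponent_sum (pos_word xs) = size xs.
Proof.
elim: xs => [|x xs IH]; first by rewrite /exponent_sum big_nil.
by rewrite -[pos_word _]cat1s exponent_sum_cat IH /exponent_sum big_seq1 /=; lia.
Qed.

(** A trivial entry contributes 0 and a conjugate of a generator contributes 1, so equality leaves
    no room for trivial entries. *)
Lemma exponent_sum_le_size (s : seq FG) :
    {in s, forall g, g = 1 \/ exists x A, g = pres_gen _ x ^ cls A} ->
  exists w, [/\ cls w = \prod_(g <- s) g, (exponent_sum w <= (size s)%:Z)%R &
    exponent_sum w = size s -> exists2 ps,
      {in ps, forall p, reduced (conj_word p.2 p.1)} & s = map conj_elt ps].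
Proof.
elim: s => [|g s IH] sg.
  exists [::]; rewrite big_nil /exponent_sum big_nil; split=> // _.
  by exists [::].
have [h hs|w [wE szw psE]] := IH; first by apply: sg; rewrite inE hs orbT.
rewrite big_cons -wE.
have [|->|[x [A ->]]] := sg g; first by rewrite inE eqxx.
  exists w; rewrite mul1g; split=> //=; lia.
have [B [_ Br eB]] := conj_word_reduced_rep x A.
exists (conj_word x B ++ w).
rewrite pres_classM eB cls_conj_word exponent_sum_cat exponent_sum_conj_word /=.
split=> //; first by lia.
move=> /= sw; have [|ps psr ->] := psE; first by lia.
exists ((B, x) :: ps); last by rewrite /= /conj_elt /= eB cls_conj_word.
by move=> q; rewrite inE => /orP[/eqP->|/psr].
Qed.

Lemma hurwitz_gens xs (s : seq FG) :
    {in s, forall g, g = 1 \/ exists x A, g = pres_gen _ x ^ cls A} ->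
    size s = size xs -> \prod_(g <- s) g = \prod_(x <- xs) pres_gen _ x ->
  hurwitz s (map (pres_gen _) xs).
Proof.
move=> /exponent_sum_le_size[w [wE _ psE]] szs prodE.
have [|ps psr sE] := psE.
  rewrite szs -exponent_sum_pos_word; apply/exponent_sum_eqv/pres_classP.
  by rewrite wE prodE cls_pos_word.
rewrite sE; apply: hurwitz_conj_elts psr _ _.
  by rewrite -szs sE size_map.
by rewrite -prodE sE big_map.
Qed.

End FreeGroup.

(** Inverses of generators form a separate case because a property such as mapping a set into itself
    need not pass to inverses. *)
Lemma pres_ind (X : choiceType) (R : word X -> word X -> Prop)
    (P : presented R -> Prop) :
    P 1 -> (forall p q, P p -> P q -> P (p * q)) ->
    (forall x, P (pres_gen R x)) -> (forall x, P (pres_gen R x)^-1) ->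
  forall p, P p.
Proof.
move=> P1 PM Pg PV p; have [u ->] := pres_surj p; elim: u => // -[x b] u IHu.
rewrite -cat1s pres_classM; apply: PM IHu.
by rewrite pres_class_letter; case: b.
Qed.

(** * The braid orbit of the tuple of generators *)

Section ArtinOrbit.
Variables (r k : nat) (hrk : (r <= k)%N).
Implicit Types (i : 'I_r.-1) (b : braid_group r) (s t : seq (free_group k)).

Local Notation strand := (strand hrk).
Local Notation strandS := (strandS hrk).

Lemma artin_bgenK i : cancel (artin hrk (bgen i)) (artin hrk (bgen i)^-1).
Proof. by move=> x; rewrite -autME -artinM mulVg artin1. Qed.

Lemma artin_bgenV_strandS i :
  artin hrk (bgen i)^-1 (fgen (strandS i)) = fgen (strand i).
Proof.
rewrite -[RHS](artin_bgenK i) artin_bgen.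
by rewrite (@artin_gen_strand _ _ _ i (strand i)).
Qed.

Lemma artin_bgenV_strand i :
  artin hrk (bgen i)^-1 (fgen (strand i)) =
  fgen (strandS i) ^ (fgen (strand i))^-1.
Proof.
have := artin_bgenK i (fgen (strandS i)).
rewrite {1}artin_bgen (@artin_gen_strandS _ _ _ i (strandS i)) // autJ.
by rewrite artin_bgenV_strandS => <-; rewrite conjgK.
Qed.

Lemma artin_bgenV_fix i (j : 'I_k) : val j != i -> val j != i.+1 ->
  artin hrk (bgen i)^-1 (fgen j) = fgen j.
Proof.
move=> ji jSi; rewrite -[RHS](artin_bgenK i) artin_bgen.
by rewrite artin_gen_fix.
Qed.

Definition strands : seq 'I_k := map (widen_ord hrk) (enum 'I_r).

Definition base : seq (free_group k) := map (@fgen k) strands.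

Lemma strands_split i : exists u v,
  [/\ strands = u ++ [:: strand i, strandS i & v], size u = i &
      {in u ++ v, forall j : 'I_k, val j != i /\ val j != i.+1}].
Proof.
have sz : size strands = r by rewrite size_map size_enum_ord.
have nthE (j : 'I_k) : j < r -> nth j strands j = j.
  move=> jr; rewrite (nth_map (Ordinal jr)) ?size_enum_ord //.
  by apply: val_inj; rewrite /= nth_enum_ord.
have ir : i.+1 < r by have := ltn_ord i; lia.
have strandsE : strands =
    take i strands ++ [:: strand i, strandS i & drop i.+2 strands].
  rewrite -[LHS](cat_take_drop i); congr (_ ++ _).
  rewrite (drop_nth (strand i)) ?sz ?(ltnW ir) //.
  rewrite (drop_nth (strandS i)) ?sz //.
  by rewrite (nthE (strand i)) ?(ltnW ir) // (nthE (strandS i)).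
exists (take i strands), (drop i.+2 strands).
split=> //; first by rewrite size_takel // sz; lia.
have : uniq strands.
  by rewrite map_inj_uniq ?enum_uniq // => a b /(congr1 val) /= /val_inj.
rewrite {1}strandsE => un j jin.
have : uniq [:: strand i, strandS i & take i strands ++ drop i.+2 strands].
  by rewrite -(cat1s (strandS i)) -(cat1s (strand i)) catA uniq_catCA.
case/and3P; rewrite inE negb_or => /andP[_ iN] SiN _; split.
  by apply: contraNneq iN => /(@val_inj _ _ _ j (strand i)) <-.
by apply: contraNneq SiN => /(@val_inj _ _ _ j (strandS i)) <-.
Qed.

(** Links the two actions: on [base], the Artin generator [i] is the Hurwitz move at position [i],
    and its inverse is the inverse move. *)
Lemma base_split i : exists u v, let f := fgen (strand i) in
  let g := fgen (strandS i) in
  [/\ base = u ++ [:: f, g & v], size u = i,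
      map (artin hrk (bgen i)) base = u ++ [:: g, f ^ g & v] &
      map (artin hrk (bgen i)^-1) base = u ++ [:: g ^ f^-1, f & v]].
Proof.
have [u [v [eb su uvN]]] := strands_split i.
exists (map (@fgen k) u), (map (@fgen k) v); rewrite size_map /base eb !map_cat /=.
have fixed j : j \in u ++ v -> artin hrk (bgen i) (fgen j) = fgen j /\
    artin hrk (bgen i)^-1 (fgen j) = fgen j.
  move=> /uvN[ji jSi]; rewrite artin_bgenV_fix // artin_bgen.
  by rewrite artin_gen_fix.
rewrite artin_bgenV_strand artin_bgenV_strandS.
rewrite {2 3}artin_bgen (@artin_gen_strand _ _ _ i (strand i)) //.
rewrite (@artin_gen_strandS _ _ _ i (strandS i)) //.
split=> //; rewrite -!map_comp; congr (_ ++ [:: _, _ & _]);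
  apply/eq_in_map => j ju /=.
all: by have [] := fixed j; rewrite ?mem_cat ?ju ?orbT.
Qed.

Definition base_orbit s := exists b, map (artin hrk b) base = s.

(** Automorphisms commute with moves, so a move at position [i] on the image of [base] under [b] is
    the image under [b] of the moved [base]. It therefore replaces [b] by [b * bgen i], with the
    generator on the right. *)
Lemma base_orbit_move u (a c : free_group k) v :
  base_orbit (u ++ [:: a, c & v]) <-> base_orbit (u ++ [:: c, a ^ c & v]).
Proof.
have szb : size base = r by rewrite size_map size_map size_enum_ord.
(* The position of the move serves as the index of the generator; an adjacent pair starting there
   forces it below [r.-1]. *)
have ir (b d : free_group k) (e : braid_group r) :
    map (artin hrk e) base = u ++ [:: b, d & v] -> size u < r.-1.
  by move=> /(congr1 size); rewrite size_map szb size_cat /= => ->; lia.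
split=> -[b eb]; pose i := Ordinal (ir _ _ _ eb);
  have [u' [v' [ebase su eb1 eb2]]] := base_split i.
  exists (b * bgen i); rewrite artinM (map_comp (artin hrk b)) eb1.
  have := eb; rewrite ebase !map_cat /= => /eqP.
  by rewrite eqseq_cat ?size_map ?su // autJ => /andP[/eqP-> /eqP[-> -> ->]].
exists (b * (bgen i)^-1); rewrite artinM (map_comp (artin hrk b)) eb2.
have := eb; rewrite ebase !map_cat /= => /eqP.
rewrite eqseq_cat ?size_map ?su // => /andP[/eqP-> /eqP[fc gac ->]].
by rewrite autJ autV fc gac conjgK.
Qed.

Lemma hurwitz_base_orbit s t : hurwitz s t -> base_orbit s <-> base_orbit t.
Proof.
elim=> // [s1 s2 _ []|s1 s2 s3 _ [st ts] _ [tu ut]|s1 a c s2] //.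
  by split=> [/st|/ut].
exact: base_orbit_move.
Qed.

Lemma prod_base : \prod_(g <- base) g = fprod hrk.
Proof. by rewrite /fprod !big_map. Qed.

(** A generator changes [base] by a Hurwitz move, which preserves the product. *)
Lemma artin_fprod b : artin hrk b (fprod hrk) = fprod hrk.
Proof.
have fix_gen i : artin hrk (bgen i) (fprod hrk) = fprod hrk.
  have [u [v [ebase _ eb _]]] := base_split i.
  rewrite -{1}prod_base.
  have -> : artin hrk (bgen i) (\prod_(g <- base) g) =
            \prod_(g <- map (artin hrk (bgen i)) base) g.
    by rewrite [RHS]big_map; apply: (big_morph _ (autM _) (aut1 _)).
  by rewrite eb -prod_base ebase; apply/hurwitz_prod/HurwitzSym/HurwitzMove.
elim/pres_ind: b => [|b c bE cE|//|i]; first by rewrite artin1.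
  by rewrite artinM autME cE bE.
by rewrite -{1}(fix_gen i) artin_bgenK.
Qed.

Lemma FQP l (g : free_group k) :
  FQ l g <-> g = 1 \/ exists j : 'I_k, exists2 y, j < l & g = fgen j ^ y.
Proof.
split=> [[->|[j jl [y _ <-]]]|[->|[j [y jl ->]]]]; first by left.
- by right; exists j, y.
- by left.
- by right; exists j => //; exists y.
Qed.

(** A braid generator or its inverse sends each [fgen j] to a conjugate of itself or of one of the
    two strands involved, whose indices lie below [r], hence below [l]. *)
Lemma artin_FQ l b (g : free_group k) : r <= l -> FQ l g -> FQ l (artin hrk b g).
Proof.
move=> rl; elim/pres_ind: b g => [|b c IHb IHc|i|i] g.
- by rewrite artin1.
- by rewrite artinM autME => /IHc/IHb.
- have lti := ltn_ord i.
  move/FQP=> [->|[j [y jl ->]]]; apply/FQP; first by left; rewrite aut1.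
  right; rewrite autJ artin_bgen.
  have [/eqP ji|ji] := boolP (val j == i).
    rewrite artin_gen_strand //; exists (strandS i); eexists; last by [].
    by rewrite /=; lia.
  have [/eqP jSi|jSi] := boolP (val j == i.+1).
    rewrite artin_gen_strandS // -conjgM.
    exists (strand i); eexists; last by []; rewrite /=; lia.
  by rewrite artin_gen_fix //; exists j; eexists; last by [].
have lti := ltn_ord i.
move/FQP=> [->|[j [y jl ->]]]; apply/FQP; first by left; rewrite aut1.
right; rewrite autJ.
have [/eqP ji|ji] := boolP (val j == i).
  have -> : j = strand i by apply: val_inj.
  rewrite artin_bgenV_strand -conjgM.
  exists (strandS i); eexists; last by []; rewrite /=; lia.
have [/eqP jSi|jSi] := boolP (val j == i.+1).
  have -> : j = strandS i by apply: val_inj.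
  rewrite artin_bgenV_strandS.
  exists (strand i); eexists; last by []; rewrite /=; lia.
by rewrite artin_bgenV_fix //; exists j; eexists; last by [].
Qed.

Lemma decomposition_base_orbit l (g : r.-tuple (free_group k)) :
  decompositions l hrk g -> base_orbit g.
Proof.
move=> [gFQ gprod]; apply/(@hurwitz_base_orbit _ base); last first.
  by exists 1; rewrite artin1 map_id.
apply: hurwitz_gens.
- move=> x /tnthP[i ->]; have /FQP[->|[j [y _ ->]]] := gFQ i; first by left.
  by right; have [A ->] := pres_surj y; exists j, A.
- by rewrite size_tuple size_map size_enum_ord.
- by rewrite big_tuple gprod -prod_base big_map.
Qed.

End ArtinOrbit.

Theorem proposition3 (r l k : nat) (hrl : (r <= l)%N) (hlk : (l <= k)%N) :
  let hrk : (r <= k)%N := leq_trans hrl hlk in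
  (forall b : braid_group r, artin hrk b (fprod hrk) = fprod hrk) /\
  transitive_on (artin_tuple hrk) (decompositions l hrk).
Proof.
move=> hrk; split; first exact: artin_fprod.
split.
(* Nonemptiness: the tuple of the first [r] generators is itself a decomposition. *)
- have sz : size (base hrk) == r by rewrite size_map size_map size_enum_ord.
  exists (Tuple sz); split; last by rewrite -prod_base [RHS](big_tuple _ _ (Tuple sz)).
  move=> i; have /mapP[j /mapP[a _ ->] ->] := mem_tnth i (Tuple sz).
  apply/FQP; right; exists (widen_ord hrk a), 1; last by rewrite conjg1.
  exact: leq_trans (ltn_ord a) hrl.
- move=> b g [gFQ gprod]; split=> [i|]; first by rewrite tnth_map; apply: artin_FQ.
  rewrite -[RHS](artin_fprod hrk b) -gprod.
  under eq_bigr do rewrite tnth_map.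
  by symmetry; apply: big_morph; [exact: autM | exact: aut1].
- move=> g h /decomposition_base_orbit[b bg] /decomposition_base_orbit[c ch].
  (* Both tuples are translates of [base], by [b] and by [c], so one goes back to [base] and then
     out to [h]. *)
  exists (c * b^-1); apply: val_inj; rewrite /= -bg -ch -map_comp.
  apply: eq_map => x /=.
  by rewrite artinM autME -(autME _ _ x) -artinM mulVg artin1.
Qed.
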